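(* Let $n,m,M$ be positive integers, let $(A_i,B_i)\in\mathbb{R}^{n\times n}\times\mathbb{R}^{n\times m}$ for $i\in\langle M\rangle$, and let $\mathcal{G}=(S,E)$ be a complete graph on $\langle M\rangle$. Suppose there exist positive definite matrices $\{P_s\}_{s\in S}\subset\mathbb{S}_+^{n\times n}$ and matrices $\{K_s\}_{s\in S}\subset\mathbb{R}^{m\times n}$ such that $$(A_i+B_iK_a)^\top P_b(A_i+B_iK_a)-P_a\prec 0\qquad\text{for all } e=(a,b,i)\in E.$$ Let $\gamma:\mathbb{R}^n\to S$ be any function satisfying $$\gamma(x)\in\operatorname*{argmin}_{s\in S}\{x^\top P_s x\}\qquad\text{for all }x\in\mathbb{R}^n$$ and for which the map $\Phi:\mathbb{R}^n\to\mathbb{R}^m$, $\Phi(x):=K_{\gamma(x)}x$, is piecewise linear. Then $\Phi$ robustly exponentially stabilizes the switched system $x(k+1)=A_{\sigma(k)}x(k)+B_{\sigma(k)}u(k)$, that is, the closed-loop switched system $$x(k+1)=A_{\sigma(k)}x(k)+B_{\sigma(k)}\Phi(x(k)),\qquad k\in\mathbb{N},\ \sigma:\mathbb{N}\to\langle M\rangle,$$ is uniformly exponentially stable.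
   Context: Notation: $\mathbb{N}$ includes $0$; $\langle M\rangle:=\{1,\dots,M\}$; $\mathbb{S}_+^{n\times n}$ is the set of symmetric positive definite real $n\times n$ matrices; for symmetric matrices, $X\prec 0$ means negative definite. Graphs: a (labeled, directed) graph $\mathcal{G}=(S,E)$ on $\langle M\rangle$ consists of a finite set of nodes $S$ and a set of labeled edges $E\subset S\times S\times\langle M\rangle$. It is complete if for all $a\in S$ and all $i\in\langle M\rangle$ there exists at least one $b\in S$ with $(a,b,i)\in E$. Piecewise linear: a function $\Psi:\mathbb{R}^n\to\mathbb{R}^m$ is piecewise linear if (i) $\Psi(\lambda x)=\lambda\Psi(x)$ for all $\lambda\in\mathbb{R}_+$, $x\in\mathbb{R}^n$; and (ii) for some positive integer $c$ there exist closed convex cones $C_1,\dots,C_c\subset\mathbb{R}^n$ and linear maps $\Xi_1,\dots,\Xi_c:\mathbb{R}^n\to\mathbb{R}^m$ such that $\bigcup_{j}C_j=\mathbb{R}^n$, $\mathrm{Int}(C_i)\cap\mathrm{Int}(C_j)=\emptyset$ for $i\neq j$, and $\Psi(x)=\Xi_j(x)$ for all $x\in\mathrm{Int}(C_j)$ and all $j$. (Continuity is not required.) Stability: given $f_1,\dots,f_M:\mathbb{R}^n\to\mathbb{R}^n$ with $f_j(0)=0$, the switched system $x(k+1)=f_{\sigma(k)}(x(k))$, $x(0)=x_0$, is uniformly exponentially stable (UES) if there exist $C>0$ and $\mu\in[0,1)$ such that for every switching signal $\sigma:\mathbb{N}\to\langle M\rangle$ and every $x_0\in\mathbb{R}^n$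 the solution satisfies $|x(k)|\le C\mu^k|x_0|$ for all $k\in\mathbb{N}$. Here $f_i(x)=A_ix+B_i\Phi(x)$. *)

(* Defs.v *)
(* Vectors of R^n are columns, of type 'cV[R]_n. *)
From mathcomp Require Import all_boot all_order all_algebra.
From mathcomp Require Import all_classical all_reals all_analysis.

Set Implicit Arguments.
Unset Strict Implicit.
Unset Printing Implicit Defensive.

Import Order.TTheory GRing.Theory Num.Theory.
Import numFieldNormedType.Exports.

Local Open Scope classical_set_scope.
Local Open Scope ring_scope.

Definition qform (R : realType) (n : nat) (P : 'M[R]_n) (x : 'cV[R]_n) : R :=
  (x^T *m P *m x) 0 0.

Definition posdefmx (R : realType) (n : nat) (P : 'M[R]_n) : Prop :=
  P^T = P /\ forall x : 'cV[R]_n, x != 0 -> 0 < qform P x.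

Definition negdefmx (R : realType) (n : nat) (P : 'M[R]_n) : Prop :=
  P^T = P /\ forall x : 'cV[R]_n, x != 0 -> qform P x < 0.

(* The norm that MathComp-Analysis puts on matrices is the max norm. *)
Definition enorm (R : realType) (n : nat) (x : 'cV[R]_n) : R :=
  Num.sqrt (\sum_(i < n) x i 0 ^+ 2).

(* The labels 1, ..., M are represented by 'I_M. *)
Definition complete_graph (M : nat) (S : finType) (E : {set S * S * 'I_M}) :
    Prop :=
  forall (a : S) (i : 'I_M), exists b : S, (a, b, i) \in E.

Definition argmin (R : realType) (S : Type) (F : S -> R) : set S :=
  [set s | forall t, F s <= F t].

Definition is_cone (R : realType) (n : nat) (C : set 'cV[R]_n) : Prop :=
  forall (l : R) (x : 'cV[R]_n), 0 <= l -> C x -> C (l *: x).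

(* Continuity is not required: Psi is only prescribed on the interiors of the
   cones, and homogeneous elsewhere. *)
Definition piecewise_linear (R : realType) (n m : nat)
    (Psi : 'cV[R]_n -> 'cV[R]_m) : Prop :=
  (forall (l : R) (x : 'cV[R]_n), 0 <= l -> Psi (l *: x) = l *: Psi x) /\
  exists (c : nat) (C : 'I_c -> set 'cV[R]_n)
         (Xi : 'I_c -> {linear 'cV[R]_n -> 'cV[R]_m}),
    [/\ (0 < c)%N,
        forall j, [/\ closed (C j), convex_set (C j) & is_cone (C j)],
        \bigcup_j C j = setT,
        forall i j, i != j -> interior (C i) `&` interior (C j) = set0
      & forall j x, interior (C j) x -> Psi x = Xi j x].

Fixpoint switched_sol (R : realType) (n M : nat)
    (f : 'I_M -> 'cV[R]_n -> 'cV[R]_n) (sigma : nat -> 'I_M) (x0 : 'cV[R]_n)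
    (k : nat) : 'cV[R]_n :=
  if k is k'.+1 then f (sigma k') (switched_sol f sigma x0 k') else x0.

(* Uniform exponential stability; f j 0 = 0 follows from the bound at k = 1. *)
Definition UES (R : realType) (n M : nat)
    (f : 'I_M -> 'cV[R]_n -> 'cV[R]_n) : Prop :=
  exists C mu : R, [/\ 0 < C, 0 <= mu, mu < 1 &
    forall (sigma : nat -> 'I_M) (x0 : 'cV[R]_n) (k : nat),
      enorm (switched_sol f sigma x0 k) <= C * mu ^+ k * enorm x0].

Definition closed_loop (R : realType) (n m M : nat)
    (A : 'I_M -> 'M[R]_n) (B : 'I_M -> 'M[R]_(n, m))
    (Phi : 'cV[R]_n -> 'cV[R]_m) (i : 'I_M) (x : 'cV[R]_n) : 'cV[R]_n :=
  A i *m x + B i *m Phi x.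

Definition robustly_exponentially_stabilizes (R : realType) (n m M : nat)
    (A : 'I_M -> 'M[R]_n) (B : 'I_M -> 'M[R]_(n, m))
    (Phi : 'cV[R]_n -> 'cV[R]_m) : Prop :=
  UES (closed_loop A B Phi).

(* Main.v *)
(* V x = min_s x^T P_s x is a common Lyapunov function. If a = gamma x attains
   the minimum at x, completeness provides an edge (a, b, i) for the active
   label i, and V (f_i x) is at most the P_b-form of
   f_i x = (A_i + B_i K_a) x, which by the matrix inequality of that edge is
   smaller than V x. Compactness of the unit sphere and finiteness of the graph
   make the decrease geometric with a uniform rate, and make V uniformly
   comparable to |x|^2. *)
Require Import Defs.
From mathcomp Require Import all_boot all_order all_algebra.
From mathcomp Require Import all_classical all_reals all_analysis.

Set Implicit Arguments.
Unset Strict Implicit.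
Unset Printing Implicit Defensive.

Import Order.TTheory GRing.Theory Num.Theory.
Import numFieldNormedType.Exports.

Local Open Scope ring_scope.

Lemma qformE (R : realType) (n : nat) (Q : 'M[R]_n) (x : 'cV[R]_n) :
  qform Q x = \sum_i (\sum_j x j 0 * Q j i) * x i 0.
Proof.
rewrite /qform mxE; apply: eq_bigr => i _; rewrite mxE; congr (_ * _).
by apply: eq_bigr => j _; rewrite mxE.
Qed.

Lemma qform1 (R : realType) (n : nat) (x : 'cV[R]_n) :
  qform 1%:M x = \sum_i x i 0 ^+ 2.
Proof.
by rewrite /qform mulmx1 mxE; apply: eq_bigr => i _; rewrite mxE expr2.
Qed.

Lemma qform0 (R : realType) (n : nat) (Q : 'M[R]_n) : qform Q 0 = 0.
Proof. by rewrite /qform mulmx0 mxE. Qed.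

Lemma qformZ (R : realType) (n : nat) (Q : 'M[R]_n) (a : R) (x : 'cV[R]_n) :
  qform Q (a *: x) = a ^+ 2 * qform Q x.
Proof. by rewrite /qform -scalemxAr linearZ -!scalemxAl !mxE expr2 mulrA. Qed.

Lemma qformN (R : realType) (n : nat) (Q : 'M[R]_n) (x : 'cV[R]_n) :
  qform (- Q) x = - qform Q x.
Proof. by rewrite /qform mulmxN mulNmx mxE. Qed.

Lemma qform_congr_sub (R : realType) (n : nat) (F P Q : 'M[R]_n)
    (x : 'cV[R]_n) :
  qform (F^T *m P *m F - Q) x = qform P (F *m x) - qform Q x.
Proof.
rewrite /qform mulmxBr mulmxBl trmx_mul !mulmxA.
by rewrite [LHS]mxE [X in _ + X]mxE.
Qed.

Lemma qform1_gt0 (R : realType) (n : nat) (x : 'cV[R]_n) :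
  x != 0 -> 0 < qform 1%:M x.
Proof.
move=> x0; rewrite qform1 lt_neqAle sumr_ge0 ?andbT => [|i _].
  rewrite eq_sym; apply: contra x0 => /eqP.
  move=> /psumr_eq0P s0; apply/eqP/matrixP => i j; rewrite ord1 mxE.
  by apply/eqP; rewrite -sqrf_eq0 s0// => k _; exact: sqr_ge0.
exact: sqr_ge0.
Qed.

Lemma qform_ge0 (R : realType) (n : nat) (Q : 'M[R]_n) (x : 'cV[R]_n) :
  (forall y : 'cV[R]_n, y != 0 -> 0 < qform Q y) -> 0 <= qform Q x.
Proof.
by move=> Q_gt0; have [->|/Q_gt0/ltW//] := eqVneq x 0; rewrite qform0.
Qed.

Lemma continuous_qform_tr (R : realType) (n : nat) (Q : 'M[R]_n) :
  continuous (fun v : 'rV[R]_n => qform Q v^T).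
Proof.
rewrite (_ : (fun _ => _) =
  fun w : 'rV[R]_n => \sum_i (\sum_j w 0 j * Q j i) * w 0 i); last first.
  apply/funext => w; rewrite qformE; apply: eq_bigr => i _; rewrite mxE.
  by congr (_ * _); apply: eq_bigr => j _; rewrite mxE.
apply: continuous_big => [|i _]; first exact: add_continuous.
move=> w; apply: continuousM; last exact: coord_continuous.
apply: continuous_big w => [|j _ w]; first exact: add_continuous.
apply: continuousM; [exact: coord_continuous | exact: cst_continuous].
Qed.

(* The quotient L / Q is homogeneous of degree 0, hence bounded by its maximum
   on the unit sphere; the sphere is taken in row vectors, the only shape for
   which the library has the Heine-Borel theorem. *)
Lemma qform_dominated (R : realType) (n : nat) (L Q : 'M[R]_n) :
  (forall x : 'cV[R]_n, x != 0 -> 0 < qform Q x) ->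
  \forall C \near +oo, forall x : 'cV[R]_n, qform L x <= C * qform Q x.
Proof.
(* The sphere is that of the max norm; by homogeneity any norm would serve. *)
move=> Q_gt0; pose A := [set v : 'rV[R]_n | `|v| = 1]%classic.
have AZ (x : 'cV[R]_n) : x != 0 -> A (`|x^T|^-1 *: x^T).
  move=> x0; rewrite /A /= normrZ normfV normr_id mulVf// normr_eq0.
  by rewrite -(inj_eq (@trmx_inj _ _ _)) trmxK trmx0.
(* One constant suffices: [qform Q x] is nonnegative, so every larger constant works too. *)
suff [C LQ] : exists C : R, forall x, qform L x <= C * qform Q x.
  near=> D => x; apply: le_trans (LQ x) _.
  by rewrite ler_wpM2r ?qform_ge0//; near: D; exact: nbhs_pinfty_ge.
have A_neq0 (v : 'rV[R]_n) : A v -> v^T != 0.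
  move=> Av; apply/eqP => /(congr1 trmx); rewrite trmxK trmx0 => v0.
  by move: Av; rewrite /A /= v0 normr0 => /esym/eqP; rewrite oner_eq0.
(* The maximum needs a nonempty sphere; if 0 is the only vector, both forms vanish identically. *)
have [[x x0]|allx0] := pselect (exists x : 'cV[R]_n, x != 0); last first.
  exists 0 => x; have [->|x0] := eqVneq x 0; first by rewrite !qform0 mul0r.
  by case: allx0; exists x.
have cptA : compact A.
  apply: bounded_closed_compact.
    by exists 1; split => // M M1 v; rewrite /A /= => ->; exact: ltW.
  have /continuous_closedP clA := @norm_continuous R 'rV[R]_n.
  exact: clA _ (@closed_eq R 1).
have [||v _ vmax] := @EVT_max_rV R n
    (fun v => qform L v^T / qform Q v^T) A _ cptA.
- by exists (`|x^T|^-1 *: x^T); exact: AZ.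
- apply: continuous_in_subspaceT => v /set_mem Av.
  apply: (@continuousM R _ (fun v => qform L v^T) (fun v => (qform Q v^T)^-1)).
    exact: continuous_qform_tr.
  apply: continuousV; last exact: continuous_qform_tr.
  by rewrite gt_eqF ?Q_gt0 ?A_neq0.
exists (qform L v^T / qform Q v^T) => y.
have [->|y0] := eqVneq y 0; first by rewrite !qform0 mulr0.
have Ay := AZ _ y0; have := vmax _ (mem_set Ay).
have := A_neq0 _ Ay; rewrite linearZ /= trmxK => ay0.
(* Both forms at the normalized vector carry the same squared factor, which is positive and
   cancels. *)
rewrite ler_pdivrMr ?Q_gt0// !qformZ mulrCA ler_pM2l//.
by rewrite exprn_even_gt0//=; apply: contraNneq ay0 => ->; rewrite scale0r.
Unshelve. all: by end_near.
Qed.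

Theorem proposition3 (R : realType) (n m M : nat)
    (n_gt0 : (0 < n)%N) (m_gt0 : (0 < m)%N) (M_gt0 : (0 < M)%N)
    (A : 'I_M -> 'M[R]_n) (B : 'I_M -> 'M[R]_(n, m))
    (S : finType) (E : {set S * S * 'I_M}) (E_complete : complete_graph E)
    (P : S -> 'M[R]_n) (K : S -> 'M[R]_(m, n))
    (P_posdef : forall s : S, posdefmx (P s))
    (lyap : forall (a b : S) (i : 'I_M), (a, b, i) \in E ->
       negdefmx ((A i + B i *m K a)^T *m P b *m (A i + B i *m K a) - P a))
    (gamma : 'cV[R]_n -> S)
    (gamma_argmin : forall x : 'cV[R]_n,
       argmin (fun s : S => qform (P s) x) (gamma x))
    (Phi_pwl : piecewise_linear (fun x : 'cV[R]_n => K (gamma x) *m x)) :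
  robustly_exponentially_stabilizes A B (fun x : 'cV[R]_n => K (gamma x) *m x).
Proof.
have P_gt0 s (x : 'cV[R]_n) : x != 0 -> 0 < qform (P s) x.
  by case: (P_posdef s) => _; exact.
(* Each bound holds for all large [C]; as there are finitely many nodes and labels, a single [C]
   serves all of them. *)
have [C [C_ge1 lowerP upperP decP]] : exists C : R,
    [/\ 1 <= C, forall s x, qform 1%:M x <= C * qform (P s) x,
        forall s x, qform (P s) x <= C * qform 1%:M x
      & forall e : S * S * 'I_M, e \in E -> forall x, qform (P e.1.1) x <= C *
          (qform (P e.1.1) x -
           qform (P e.1.2) ((A e.2 + B e.2 *m K e.1.1) *m x))].
  near (@pinfty_nbhs R) => C; exists C; split; near: C.
  - exact: nbhs_pinfty_ge.
  - by apply: filter_forall => s; exact: (qform_dominated _ (P_gt0 s)).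
  - by apply: filter_forall => s; exact: (qform_dominated _ (@qform1_gt0 R n)).
  - apply: filter_forall => -[[a b] i] /=.
    have [/lyap[_ neg]|] := boolP ((a, b, i) \in E); last first.
      by move=> _; exact: nearW.
    (* On an edge [- N] is positive definite, so it dominates [P a]; its form at [x] is exactly the
       decrease along that edge. *)
    pose N := (A i + B i *m K a)^T *m P b *m (A i + B i *m K a) - P a.
    have /(qform_dominated (P a)) : forall x, x != 0 -> 0 < qform (- N) x.
      by move=> x x0; rewrite qformN oppr_gt0; exact: neg.
    apply: filterS => C PN _ x.
    by have := PN x; rewrite qformN qform_congr_sub opprB.
have C_gt0 : 0 < C by exact: lt_le_trans C_ge1.
(* Dividing [V x <= C * (V x - v)] by [C] gives [v <= rho * V x], where [v] is the form of the
   successor node at the next state; [1 <= C] makes [rho] nonnegative. *)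
pose V x := qform (P (gamma x)) x; pose rho := 1 - C^-1.
have [rho_ge0 rho_lt1] : 0 <= rho /\ rho < 1.
  by rewrite subr_ge0 invf_le1// gtrBl invr_gt0.
pose f := closed_loop A B (fun x => K (gamma x) *m x).
have V_step i x : V (f i x) <= rho * V x.
  have [b eE] := E_complete (gamma x) i.
  have := decP _ eE x => /= decr.
  have fE : f i x = (A i + B i *m K (gamma x)) *m x.
    by rewrite /f /closed_loop mulmxDl mulmxA.
  (* The node chosen at [f i x] need not be [b], but by minimality its form there is at most that of
     [P b]. *)
  apply: le_trans (gamma_argmin (f i x) b) _; rewrite [in leLHS]fE.
  move: decr; rewrite -ler_pdivrMl// /rho mulrBl mul1r => decr.
  by rewrite lerBrDr -lerBrDl.
have V_sol sigma x0 k : V (switched_sol f sigma x0 k) <= rho ^+ k * V x0.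
  elim: k => [|k IHk]; first by rewrite expr0 mul1r.
  by apply: le_trans (V_step _ _) _; rewrite exprS -mulrA ler_wpM2l.
(* Sandwiching [V] gives [|x(k)|^2 <= C * V (x(k)) <= C * rho^k * V x0 <= C^2 * rho^k * |x0|^2];
   square roots yield the factor [C] and the rate [Num.sqrt rho]. *)
exists C, (Num.sqrt rho); split; rewrite ?sqrtr_ge0//.
  by rewrite -(sqrtr1 R) ltr_sqrt.
move=> sigma x0 k; rewrite /enorm -!qform1.
have -> : C * Num.sqrt rho ^+ k = Num.sqrt (C ^+ 2 * rho ^+ k).
  rewrite sqrtrM ?sqr_ge0// sqrtr_sqr ger0_norm ?ltW//; congr (_ * _).
  elim: k => [|k IHk]; first by rewrite !expr0 sqrtr1.
  by rewrite !exprS sqrtrM// IHk.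
have Crho_ge0 : 0 <= C ^+ 2 * rho ^+ k by rewrite mulr_ge0 ?sqr_ge0 ?exprn_ge0.
rewrite -sqrtrM//; apply: ler_wsqrtr.
apply: le_trans (lowerP _ _) _.
rewrite expr2 -!mulrA ler_pM2l//.
apply: le_trans (V_sol sigma x0 k) _.
rewrite mulrCA ler_wpM2l ?exprn_ge0//; exact: upperP.
Unshelve. all: by end_near.
Qed.
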